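(* Let $T\in\{0,1\}$ be a treatment, $Z$ an observed covariate, and $Y(0),Y(1)$ potential outcomes, with conditional laws $P_{t,s,z}=\mathcal L(Y(t)\mid T=s,Z=z)$ and $P_{t,z}=\mathcal L(Y(t)\mid Z=z)$, $t,s\in\{0,1\}$. Assume positivity: $0<e(z):=\mathbb P(T=1\mid Z=z)<1$ for $P_Z$-a.e. $z$. Let $\Psi$ be a summary map that is injective on the model class of laws under consideration (a class containing $P_{t,t,z}$ and $P_{t,z}$ for $t\in\{0,1\}$ and $P_Z$-a.e. $z$). Then the following two conditions are equivalent: (i) (conditional topological ignorability relative to $\Psi$) $\Psi(P_{t,t,z})=\Psi(P_{t,z})$ for $t\in\{0,1\}$ and $P_Z$-a.e. $z$; (ii) (weak ignorability) $Y(t)\perp T\mid Z$ for each $t\in\{0,1\}$.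
   Context: All random variables live on a complete probability space $(\Omega,\mathcal A,\mathbb P)$. $T$ takes values in $\{0,1\}$, $Z$ takes values in a standard Borel space $\mathcal Z$ with law $P_Z$, and $Y(0),Y(1)$ take values in $\mathcal Y\subseteq\mathbb R^d$. The observed outcome is $Y=Y(T)$ a.s. (consistency). All laws considered admit densities with respect to a common $\sigma$-finite measure on $\mathcal Y$; $f_\mu$ denotes the density of $\mu$. A summary map is $\Psi(\mu):=\Phi(f_\mu)$, where $\Phi$ is a measurable map from a class of densities on $\mathcal Y$ into a Banach space $(E,\|\cdot\|_E)$. Injectivity on the model class means that for laws $\mu,\mu'$ in the class, $\Psi(\mu)=\Psi(\mu')$ implies $\mu=\mu'$. *)

(* Defs.v *)
From HB Require Import structures.
From mathcomp Require Import all_boot all_order all_algebra.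
From mathcomp Require Import all_classical all_reals all_analysis.
From mathcomp Require Import measurable_realfun.
Set Implicit Arguments.
Unset Strict Implicit.
Unset Printing Implicit Defensive.
Import Order.TTheory GRing.Theory Num.Theory.
Import numFieldNormedType.Exports.
Local Open Scope classical_set_scope.
Local Open Scope ring_scope.
Local Open Scope ereal_scope.

(* The set A as a measurable space of its own, with the trace sigma-algebra
   { A `&` B | B measurable in T }.  Measurable types are pointed, hence the
   argument a, which only witnesses that A is nonempty. *)
Definition trace_space d (T : measurableType d) (A : set T) (a : A) : Type :=
  set_type A.

Section trace_space.
Context d (T : measurableType d) (A : set T) (a : A).

HB.instance Definition _ := Choice.copy (trace_space a) (set_type A).
HB.instance Definition _ := isPointed.Build (trace_space a) a.
HB.instance Definition _ := Measurable.copy (trace_space a)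
  (g_sigma_algebra_preimageType (val : trace_space a -> T)).

End trace_space.

(* A pseudometric space is metric iff it is Hausdorff, so X below ranges over
   the Polish spaces. *)
Definition standard_borel (R : realType) d (T : measurableType d) : Prop :=
  exists X : completePseudoMetricType R,
    [/\ hausdorff_space X,
        (exists2 S : set X, countable S & dense S) &
        exists2 f : T -> X, bijective f &
          forall A : set T,
            measurable A <-> exists2 B, <<s @open X >> B & A = f @^-1` B].

Section joint.
Context dO d1 d2 (Omega : measurableType dO) (S1 : measurableType d1)
  (S2 : measurableType d2) (X1 : {mfun Omega >-> S1}) (X2 : {mfun Omega >-> S2}).

Definition joint (w : Omega) : S1 * S2 := (X1 w, X2 w).

Let measurable_joint : measurable_fun setT joint.
Proof. exact: measurable_fun_pair. Qed.

HB.instance Definition _ := isMeasurableFun.Build _ _ _ _ joint measurable_joint.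

End joint.

Section conditioning.
Context (R : realType) (dO dV : measure_display)
  (Omega : measurableType dO) (V : measurableType dV).
Variable P : probability Omega R.

(* g is a version of w |-> P(E | W = w). *)
Definition is_cond_prob (E : set Omega) (W : {mfun Omega >-> V})
    (g : V -> \bar R) : Prop :=
  measurable_fun setT g /\
  forall B, measurable B ->
    \int[distribution P W]_(w in B) g w = P (E `&` W @^-1` B).

(* K is a version of the regular conditional law w |-> L(X | W = w). *)
Definition is_cond_law dS (S : measurableType dS) (X : {mfun Omega >-> S})
    (W : {mfun Omega >-> V}) (K : V -> probability S R) : Prop :=
  forall A, measurable A -> is_cond_prob (X @^-1` A) W (fun w => K w A).

(* Versions of conditional probabilities exist and agree almost everywhere, so
   it does not matter which ones are taken. *)
Definition cond_indep d1 d2 (S1 : measurableType d1) (S2 : measurableType d2)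
    (X1 : {mfun Omega >-> S1}) (X2 : {mfun Omega >-> S2})
    (W : {mfun Omega >-> V}) : Prop :=
  forall A1 A2, measurable A1 -> measurable A2 ->
  exists g g1 g2 : V -> \bar R,
    [/\ is_cond_prob (X1 @^-1` A1 `&` X2 @^-1` A2) W g,
        is_cond_prob (X1 @^-1` A1) W g1,
        is_cond_prob (X2 @^-1` A2) W g2 &
        {ae distribution P W, forall w, g w = g1 w * g2 w}].

End conditioning.

Section summaries.
Context (R : realType) (dY : measure_display) (Y : measurableType dY).
Variable nu : {sigma_finite_measure set Y -> \bar R}.

Definition prob_density : set (Y -> R) :=
  [set f : Y -> R | [/\ measurable_fun setT f, (forall y, (0 <= f y)%R) &
               \int[nu]_y (f y)%:E = 1]].

Definition is_density_of (mu : probability Y R) (f : Y -> R) : Prop :=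
  forall A, measurable A -> mu A = \int[nu]_(y in A) (f y)%:E.

(* The density of mu in the class D.  It is a function of the values of mu on
   measurable sets; when D contains several versions of it, one is chosen. *)
Definition density_in (D : set (Y -> R)) (mu : probability Y R) : Y -> R :=
  xget (cst 0%R) [set f | D f /\ is_density_of mu f].

Definition summary (E : Type) (D : set (Y -> R)) (Phi : (Y -> R) -> E)
    (mu : probability Y R) : E :=
  Phi (density_in D mu).

(* Measurability of Phi : D -> E, for a sigma-algebra SD on D and the Borel
   sigma-algebra of E. *)
Definition measurable_on_class (E : topologicalType) (D : set (Y -> R))
    (SD : set (set (Y -> R))) (Phi : (Y -> R) -> E) : Prop :=
  forall B, <<s @open E >> B -> SD (D `&` Phi @^-1` B).

(* Two laws are equal when they agree on measurable sets: a value of type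
   probability also carries irrelevant values on the other sets. *)
Definition law_eq (mu mu' : probability Y R) : Prop :=
  forall A, measurable A -> mu A = mu' A.

Definition injective_on_laws (E : Type) (M : set (probability Y R))
    (Psi : probability Y R -> E) : Prop :=
  forall mu mu', M mu -> M mu' -> Psi mu = Psi mu' -> law_eq mu mu'.

End summaries.

Section ignorability.
Context (R : realType) (dO dZ dY : measure_display)
  (Omega : measurableType dO) (Zc : measurableType dZ) (Y : measurableType dY).
Variables (P : probability Omega R) (T : {mfun Omega >-> bool})
  (Z : {mfun Omega >-> Zc}).

(* Pts t s z = L(Y(t) | T = s, Z = z)  and  Pt t z = L(Y(t) | Z = z). *)
Definition top_ignorable (E : Type) (Psi : probability Y R -> E)
    (Pts : bool -> bool -> Zc -> probability Y R)
    (Pt : bool -> Zc -> probability Y R) : Prop :=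
  forall t, {ae distribution P Z, forall z, Psi (Pts t t z) = Psi (Pt t z)}.

Definition weakly_ignorable (Ypot : bool -> {mfun Omega >-> Y}) : Prop :=
  forall t, cond_indep P (Ypot t) T Z.

End ignorability.

(* Main.v *)
Require Import Defs.
From mathcomp Require Import all_boot all_order all_algebra.
From mathcomp Require Import all_classical all_reals all_analysis.
From mathcomp Require Import measurable_realfun.
Import Order.TTheory GRing.Theory Num.Theory.
Import numFieldNormedType.Exports.
Local Open Scope classical_set_scope.
Local Open Scope ring_scope.
Local Open Scope ereal_scope.

(* Fix t and let e_t be a version of P(T = t | Z).  Disintegrating the law of
   (T, Z) along T shows that z |-> P_{t,t,z}(A) e_t(z) is a version of
   P(Y(t) in A, T = t | Z = z).  As 0 < e_t < oo a.e., uniqueness of conditional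
   probabilities makes Y(t) _||_ T | Z equivalent to: for every A,
   P_{t,t,z}(A) = P_{t,z}(A) for almost every z.  The Borel sets of a subset of
   R^n are generated by a countable pi-system, so the null set can be chosen
   independently of A, and then P_{t,t,z} = P_{t,z} as laws for almost every z.
   Injectivity of the summary map turns this into condition (i). *)

(** * Integrability and integration against a density *)

Lemma integrable_of_fin_num {d} {T : measurableType d} {R : realType}
    {mu : {measure set T -> \bar R}} {D : set T} {f : T -> \bar R} :
  measurable D -> measurable_fun D f -> \int[mu]_(x in D) f x \is a fin_num ->
  mu.-integrable D f.
Proof.
(* A difference is finite only when both terms are, so the positive and negative parts of [f] both
   have a finite integral. *)
move=> mD mf; rewrite integralE fin_numB => /andP[fp fn].
apply/integrableP; split=> //.
under eq_integral do rewrite -[`|f _|]/((abse \o f) _) fune_abse.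
rewrite ge0_integralD//; [|exact: measurable_funepos|exact: measurable_funeneg].
by rewrite lte_add_pinfty// -ge0_fin_numE// integral_ge0.
Qed.

(** [g] carries no sign assumption: it is identified almost everywhere with the Radon-Nikodym
    derivative of [nu], for which the change of variables holds. *)
Lemma ge0_integral_density {d} {T : measurableType d} {R : realType}
    {nu : {measure set T -> \bar R}} {mu : {finite_measure set T -> \bar R}}
    {g : T -> \bar R} :
  nu setT < +oo -> measurable_fun setT g ->
  (forall A, measurable A -> nu A = \int[mu]_(x in A) g x) ->
  forall f A, measurable_fun setT f -> (forall x, 0 <= f x) -> measurable A ->
  \int[nu]_(x in A) f x = \int[mu]_(x in A) (f x * g x).
Proof.
move=> nuoo mg + f A mf f0 mA.
(* Restricting to the whole space turns [nu] into a finite measure with the same values. *)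
pose nu' : {finite_measure set T -> \bar R} := mfrestr measurableT nuoo.
have nunu' B : nu B = nu' B by rewrite /nu'/= /mfrestr /mrestr setIT.
rewrite (eq_measure_integral nu') => [nug|B _ _]; last exact: nunu'.
have {}nug B : measurable B -> nu' B = \int[mu]_(x in B) g x.
  by move=> mB; rewrite -nunu' nug.
have numu : nu' `<< mu.
  apply/null_content_dominatesP => B mB B0.
  by rewrite nug// null_set_integral//; exact: measurable_funTS.
have RNint := Radon_Nikodym_SigmaFinite.f_integrable numu.
have RNg : ae_eq mu setT (Radon_Nikodym_SigmaFinite.f nu' mu) g.
  apply: integral_ae_eq => // B _ mB.
  by rewrite -nug//; exact/esym/Radon_Nikodym_SigmaFinite.f_integral.
rewrite -(Radon_Nikodym_SigmaFinite.change_of_variables numu)//; last first.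
  exact: measurable_funTS.
have mRN := measurable_int _ RNint.
apply: ae_eq_integral => //.
- by apply/measurable_funTS/emeasurable_funM.
- by apply/measurable_funTS/emeasurable_funM.
- by apply: filterS RNg => x /(_ Logic.I) -> _.
Qed.

(** * Versions of conditional probabilities *)

Section cond_prob.
Context {R : realType} {dO dV : measure_display}
  {Omega : measurableType dO} {V : measurableType dV}
  {P : probability Omega R} {W : {mfun Omega >-> V}}.

Lemma is_cond_prob_integrable {E g} : measurable E -> is_cond_prob P E W g ->
  (distribution P W).-integrable setT g.
Proof.
move=> mE [mg gE]; apply: integrable_of_fin_num => //.
by rewrite gE// preimage_setT setIT fin_num_measure.
Qed.

Lemma is_cond_prob_ae_eq {E g h} : measurable E -> is_cond_prob P E W g ->
  is_cond_prob P E W h -> {ae distribution P W, forall v, g v = h v}.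
Proof.
move=> mE gE hE.
have : ae_eq (distribution P W) setT g h.
  apply: integral_ae_eq => //; first exact: is_cond_prob_integrable gE.
    by case: hE.
  by move=> B _ mB; case: gE => _ ->//; case: hE => _ ->.
by apply: filterS => v /(_ Logic.I).
Qed.

Lemma ae_eq_is_cond_prob {E g h} : measurable_fun setT h ->
  is_cond_prob P E W g -> {ae distribution P W, forall v, g v = h v} ->
  is_cond_prob P E W h.
Proof.
move=> mh [mg gE] gh; split=> // B mB; rewrite -gE//.
apply: ae_eq_integral => //; [exact: measurable_funTS..|].
by apply: filterS gh => v ->.
Qed.

Lemma is_cond_probD {E F g h} : measurable E -> measurable F -> F `<=` E ->
  is_cond_prob P E W g -> is_cond_prob P F W h ->
  is_cond_prob P (E `\` F) W (fun v => g v - h v).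
Proof.
move=> mE mF FE gE hF.
have ig := is_cond_prob_integrable mE gE.
have ih := is_cond_prob_integrable mF hF.
have [mg gEE] := gE; have [mh hFE] := hF.
split=> [|B mB]; first exact: emeasurable_funB.
rewrite integralB//; [|exact: integrableS ig|exact: integrableS ih].
rewrite gEE// hFE//.
have mWB : measurable (W @^-1` B) by exact: measurable_funPTI.
have FEW : F `&` W @^-1` B `<=` E `&` W @^-1` B by exact: setSI.
have -> : (E `\` F) `&` W @^-1` B = (E `&` W @^-1` B) `\` (F `&` W @^-1` B).
  apply/seteqP; split=> [w [[Ew nFw] Ww]|w [[Ew Ww] nFw]].
    by split=> // -[].
  by split=> //; split=> // Fw; exact: nFw.
have mEW := measurableI _ _ mE mWB; have mFW := measurableI _ _ mF mWB.
have EWoo : P (E `&` W @^-1` B) < +oo by rewrite ltey_eq fin_num_measure.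
by rewrite measureD// (setIidr FEW).
Qed.

Lemma is_cond_probT : is_cond_prob P setT W (cst 1).
Proof.
split=> [|B mB]; first exact: measurable_cst.
by rewrite integral_cst// mul1e setTI.
Qed.

Lemma is_cond_prob0 : is_cond_prob P set0 W (cst 0).
Proof.
by split=> [|B mB]; [exact: measurable_cst|rewrite integral0 set0I measure0].
Qed.

(* Both sides integrate [h] against the law of [W] on [E], once as an image
   measure and once through its density [g]. *)
Lemma integral_is_cond_prob {E g h B} : measurable E -> is_cond_prob P E W g ->
  measurable_fun setT h -> (forall v, 0 <= h v) -> measurable B ->
  \int[distribution P W]_(v in B) (h v * g v) =
  \int[P]_(w in W @^-1` B `&` E) h (W w).
Proof.
move=> mE [mg gE] mh h0 mB.
have mW : measurable_fun setT W by exact: measurable_funP.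
have mWB : measurable (W @^-1` B) by exact: measurable_funPTI.
have Eoo : P E < +oo by rewrite ltey_eq fin_num_measure.
(* The restriction of [P] to [E] has the indicator of [E] as density, and its image under [W] has
   density [g] with respect to the law of [W]. *)
pose PE : {finite_measure set Omega -> \bar R} := mfrestr mE Eoo.
have PEd A : measurable A -> PE A = \int[P]_(w in A) (\1_E w)%:E.
  by move=> mA; rewrite integral_indic// setIC.
have PEoo : PE setT < +oo by rewrite ltey_eq fin_num_measure.
transitivity (\int[PE]_(w in W @^-1` B) h (W w)).
  rewrite -(ge0_integral_pushforward mW)//; last exact: measurable_funTS.
  apply/esym/ge0_integral_density => //.
  by move=> A mA; rewrite gE// setIC.
rewrite (ge0_integral_density PEoo _ PEd)//.
- rewrite integral_mkcondr; apply: eq_integral => w _.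
  by rewrite patchE indicE; case: (w \in E); rewrite ?mule1 ?mule0.
- exact/measurable_EFinP/measurable_indic.
- exact: measurableT_comp.
Qed.

End cond_prob.

(** * Countable generation and almost everywhere equality of laws *)

Lemma countable_image {I T : Type} {f : I -> T} {A : set I} :
  countable A -> countable (f @` A).
Proof. by apply: card_le_trans; exact: card_image_le. Qed.

Definition countably_generated {d} (T : measurableType d) : Prop :=
  exists2 G : set (set T), countable G & @measurable d T = <<s G >>.

(** Open right rays generate the Borel sets, and by density of the rationals each is a union of rays
    with rational endpoints. *)
Lemma countably_generated_real (R : realType) : countably_generated R.
Proof.
pose G := range (fun q : rat => `](ratr q : R), +oo[%classic).
exists G; first exact/countable_image.
apply/seteqP; split=> [A|].
  rewrite -[measurable A]/((@ocitv R).-sigma.-measurable A).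
  rewrite RGenOInfty.measurableE; move: A.
  apply: smallest_sub; first exact: smallest_sigma_algebra.
  move=> _ [x ->].
  have -> : `]x, +oo[%classic = \bigcup_(q : rat)
      (if (x < ratr q)%R then `](ratr q : R), +oo[%classic else set0).
    apply/seteqP; split=> [y|y [q _]]; rewrite /= in_itv/= andbT.
      move=> /rat_in_itvoo[q]; rewrite in_itv/= => /andP[xq qy].
      by exists q => //=; rewrite xq/= in_itv/= qy.
    by case: ifPn => //= xq; rewrite in_itv/= andbT; exact: lt_trans.
  apply: (@countable_bigcupT_measurable _ (g_sigma_algebraType G)) => // q.
  by case: ifPn => // _; apply: sub_sigma_algebra; exists q.
apply: smallest_sub; first exact: sigma_algebra_measurable.
by move=> _ [q _ <-]; exact: measurable_itv.
Qed.

(** The product sigma-algebra is generated by the coordinates, and generating a sigma-algebra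
    commutes with taking preimages. *)
Lemma countably_generated_tuple {d} {T : measurableType d} n :
  countably_generated T -> countably_generated (n.-tuple T).
Proof.
move=> [G cG TG].
pose H := \bigcup_(i : 'I_n) preimage_set_system setT
  (fun x : n.-tuple T => tnth x i) G.
exists H.
  by apply: bigcup_countable => // i _; exact: countable_image.
apply/seteqP; split.
  apply: smallest_sub; first exact: smallest_sigma_algebra.
  apply: (big_ind (fun X => X `<=` <<s H >>)) => [|A B|i _];
    [exact: sub0set|by rewrite subUset|].
  rewrite TG -[X in X `<=` _](@g_sigma_preimageE (n.-tuple T) T).
  apply: smallest_sub; first exact: smallest_sigma_algebra.
  by move=> A GA; apply: sub_sigma_algebra; exists i.
apply: (smallest_sub (@sigma_algebra_measurable _ (n.-tuple T))).
move=> _ [i _ [A GA <-]].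
apply: (measurable_tnth i) => //; rewrite TG; exact: sub_sigma_algebra.
Qed.

Lemma countably_generated_trace {d} {T : measurableType d} {A : set T} (a : A) :
  countably_generated T -> countably_generated (trace_space a).
Proof.
move=> [G cG TG].
exists (preimage_set_system setT (val : trace_space a -> T) G).
  exact: countable_image.
by rewrite g_sigma_preimageE -[X in preimage_set_system _ _ X]TG.
Qed.

(** Finite intersections of generators still form a countable family, and the empty intersection
    contributes the whole space; this is the pi-system for uniqueness of measures. *)
Lemma countably_generated_setI {d} {T : measurableType d} :
  countably_generated T ->
  exists G : set (set T), [/\ countable G, @measurable d T = <<s G >>,
    setI_closed G & G setT].
Proof.
move=> [G cG TG]; exists (finI_from G id); split.
- exact: finI_from_countable.
- rewrite TG; apply/seteqP; split.
    apply: smallest_sub; first exact: smallest_sigma_algebra.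
    by move=> A GA; apply: sub_sigma_algebra; exact: (finI_from1 id GA).
  apply: smallest_sub; first exact: smallest_sigma_algebra.
  move=> _ [D DG <-].
  apply: (@fin_bigcap_measurable _ (g_sigma_algebraType G)) => // B BD.
  by apply: sub_sigma_algebra; exact/set_mem/DG.
- by move=> A B; exact: finI_fromI.
- by exists finmap.fset0 => //; rewrite set_fset0 bigcap_set0.
Qed.

Lemma ae_countable {d} {T : measurableType d} {R : realType}
    {mu : {measure set T -> \bar R}} {I : Type} {G : set I}
    {Q : I -> T -> Prop} : countable G ->
  (forall i, G i -> {ae mu, forall x, Q i x}) ->
  {ae mu, forall x, forall i, G i -> Q i x}.
Proof.
move=> /countable_injP[f finj] GQ.
(* Numbers outside the image of [f] impose no condition, so the intersection can run over all of
   [nat]. *)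
have : \forall x \ae mu, forall n, forall i, G i -> f i = n -> Q i x.
  apply: ae_foralln => n.
  have [[i [Gi fi]]|nG] := pselect (exists i, G i /\ f i = n); last first.
    by apply: aeW => x i Gi fi; exfalso; apply: nG; exists i.
  apply: filterS (GQ i Gi) => x Qix j Gj fj.
  by rewrite (finj j i) ?inE// fj.
by apply: filterS => x Qx i Gi; exact: Qx (f i) i Gi erefl.
Qed.

(** One null set is discarded for each member of a countable pi-system; off their union, uniqueness
    of measures applies. *)
Lemma ae_law_eq {d1 d2} {T : measurableType d1} {Y : measurableType d2}
    {R : realType} {mu : {measure set T -> \bar R}}
    {K1 K2 : T -> probability Y R} : countably_generated Y ->
  (forall A, measurable A -> {ae mu, forall x, K1 x A = K2 x A}) ->
  {ae mu, forall x, law_eq (K1 x) (K2 x)}.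
Proof.
move=> /countably_generated_setI[G [cG YG GI GT]] K12.
have : {ae mu, forall x, forall A, G A -> K1 x A = K2 x A}.
  apply: ae_countable => // A GA; apply: K12; rewrite YG.
  exact: sub_sigma_algebra.
apply: filterS => x GK; apply: (measure_unique G (fun=> setT)) => //.
  by rewrite bigcup_const//; exists 0%N.
by move=> _; rewrite ltey_eq fin_num_measure.
Qed.

(** * Conditional independence from a binary treatment *)

Lemma is_cond_prob_stratum {R : realType} {dO d1 d2 dZ : measure_display}
    {Omega : measurableType dO} {P : probability Omega R}
    {S : measurableType d1} {Y : measurableType d2} {Zc : measurableType dZ}
    {T : {mfun Omega >-> S}} {X : {mfun Omega >-> Y}} {Z : {mfun Omega >-> Zc}}
    {K : S * Zc -> probability Y R} {t : S} {g : Zc -> \bar R} {A : set Y} :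
  is_cond_law P X (joint T Z) K -> measurable [set t] ->
  is_cond_prob P (T @^-1` [set t]) Z g -> measurable A ->
  is_cond_prob P (X @^-1` A `&` T @^-1` [set t]) Z (fun z => K (t, z) A * g z).
Proof.
move=> KX mt gt mA; have [mK KA] := KX A mA.
have mKt : measurable_fun setT (fun z => K (t, z) A).
  by apply: (measurableT_comp mK); exact: measurable_pair1.
split=> [|B mB]; first by apply: emeasurable_funM => //; case: gt.
have mE : measurable (T @^-1` [set t]) by exact: measurable_funPTI.
(* Back on [Omega], the integrand lives on the event where [T] equals [t], so it coincides with [K]
   at [(T w, Z w)]; the defining property of [K] on the rectangle with sides [[set t]] and [B] then
   applies. *)
rewrite (integral_is_cond_prob mE gt mKt)//.
have -> : X @^-1` A `&` T @^-1` [set t] `&` Z @^-1` B =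
    X @^-1` A `&` joint T Z @^-1` ([set t] `*` B).
  by rewrite -setIA.
have mtB : measurable ([set t] `*` B) by exact: measurableX.
rewrite -KA// ge0_integral_pushforward//; last exact: measurable_funTS.
have -> : joint T Z @^-1` ([set t] `*` B) = Z @^-1` B `&` T @^-1` [set t].
  by rewrite setIC.
apply: eq_integral => w /=; rewrite inE /joint => -[_ ->]//.
Qed.

Section binary_treatment.
Context {R : realType} {dO dY dZ : measure_display}
  {Omega : measurableType dO} {P : probability Omega R}
  {Y : measurableType dY} {Zc : measurableType dZ}
  {T : {mfun Omega >-> bool}} {X : {mfun Omega >-> Y}}
  {Z : {mfun Omega >-> Zc}}.

Let mT B : measurable (T @^-1` B).
Proof. exact: measurable_funPTI. Qed.

Let mX A : measurable A -> measurable (X @^-1` A).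
Proof. exact: measurable_funPTI. Qed.

Lemma is_cond_prob_treatment {e : Zc -> \bar R} t :
  is_cond_prob P (T @^-1` [set true]) Z e ->
  is_cond_prob P (T @^-1` [set t]) Z (fun z => if t then e z else 1 - e z).
Proof.
case: t => // eT.
have -> : T @^-1` [set false] = setT `\` T @^-1` [set true].
  by apply/seteqP; split=> w /=; case: (T w) => //; case.
by apply: is_cond_probD is_cond_probT eT.
Qed.

(** One value [t] suffices: the event where [T] differs from [t] is a complement, handled by
    subtraction. The bounds on [g] allow it to be cancelled. *)
Lemma cond_indep_stratum {K : bool * Zc -> probability Y R}
    {Q : Zc -> probability Y R} {t : bool} {g : Zc -> \bar R} :
  is_cond_law P X (joint T Z) K -> is_cond_law P X Z Q ->
  is_cond_prob P (T @^-1` [set t]) Z g ->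
  {ae distribution P Z, forall z, 0 < g z < +oo} ->
  cond_indep P X T Z <->
  forall A, measurable A -> {ae distribution P Z, forall z, K (t, z) A = Q z A}.
Proof.
move=> KX QX gt g0; split=> [XTZ A mA|KQ].
  have mXT : measurable (X @^-1` A `&` T @^-1` [set t]).
    by apply: measurableI; [exact: mX|exact: mT].
  have [h [h1 [h2 [hXT hX hT h12]]]] := XTZ A [set t] mA I.
  have Kgh := is_cond_prob_ae_eq mXT (is_cond_prob_stratum KX I gt mA) hXT.
  have Qh1 := is_cond_prob_ae_eq (mX _ mA) (QX A mA) hX.
  have gh2 := is_cond_prob_ae_eq (mT _) gt hT.
  apply: filter_app h12; apply: filter_app gh2; apply: filter_app Qh1.
  apply: filter_app Kgh; apply: filterS g0 => z /andP[gz0 gzoo] + Qz gz hz.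
  (* All factors are finite, so the cancellation of [g z] takes place among real numbers. *)
  rewrite hz -Qz -gz -(fineK (fin_num_measure (K (t, z)) A mA)).
  rewrite -(fineK (fin_num_measure (Q z) A mA)).
  have /fineK <- : g z \is a fin_num by rewrite ge0_fin_numE// ltW.
  rewrite -!EFinM => -[] /mulIf -> //.
  by rewrite gt_eqF// fine_gt0// gz0.
move=> A B mA mB.
have QA := QX A mA.
pose F := X @^-1` A `&` T @^-1` [set t].
have QgF : is_cond_prob P F Z (fun z => Q z A * g z).
  apply: (ae_eq_is_cond_prob _ (is_cond_prob_stratum KX I gt mA)).
    by apply: emeasurable_funM; [case: QA|case: gt].
  by apply: filterS (KQ A mA) => z ->.
have mF : measurable F by apply: measurableI; [exact: mX|exact: mT].
have Tt w : T w = t \/ T w = ~~ t.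
  by case: (T w); case: (t); [left|right|right|left].
(* The four sets of booleans give the sure event, the stratum [t], its complement and the impossible
   event. *)
have [Bt|nBt] := pselect (B t); have [Bnt|nBnt] := pselect (B (~~ t)).
- have -> : T @^-1` B = setT.
    by apply/seteqP; split=> // w _ /=; case: (Tt w) => ->.
  exists (Q ^~ A), (Q ^~ A), (cst 1); rewrite setIT; split=> //.
    exact: is_cond_probT.
  by apply: aeW => z; rewrite mule1.
- have -> : T @^-1` B = T @^-1` [set t].
    apply/seteqP; split=> w /=; last by move=> ->.
    by case: (Tt w) => // -> /nBnt.
  exists (fun z => Q z A * g z), (Q ^~ A), g; split=> //; exact: aeW.
- have -> : T @^-1` B = setT `\` T @^-1` [set t].
    apply/seteqP; split=> w /=.
      by move=> BT; split=> // Twt; apply: nBt; rewrite -Twt.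
    by move=> [_]; case: (Tt w) => // ->.
  (* Subtracting the versions for the stratum gives a product again, as
     [Q - Q * g = Q * (1 - g)]. *)
  exists (fun z => Q z A - Q z A * g z), (Q ^~ A), (fun z => 1 - g z).
  split=> //.
  + have -> : X @^-1` A `&` (setT `\` T @^-1` [set t]) = X @^-1` A `\` F.
      apply/seteqP; split=> [w [Aw [_ nt]]|w [Aw nF]]; first by split=> // -[].
      by split=> //; split=> // Tw; exact: nF.
    apply: (is_cond_probD _ mF _ QA QgF); [exact: mX|exact: subIsetl].
  + by apply: is_cond_probD is_cond_probT gt.
  + apply: filterS g0 => z /andP[gz0 gzoo].
    have gz : g z \is a fin_num by rewrite ge0_fin_numE// ltW.
    have Qz : Q z A \is a fin_num by rewrite fin_num_measure.
    by rewrite muleBr ?mule1// fin_num_adde_defl.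
- have -> : T @^-1` B = set0.
    apply/seteqP; split=> w //=.
    by case: (Tt w) => ->.
  exists (cst 0), (Q ^~ A), (cst 0); rewrite setI0; split=> //;
    [exact: is_cond_prob0..|].
  by apply: aeW => z; rewrite mule0.
Qed.

End binary_treatment.

(** * Summary maps and the equivalence *)

Lemma law_eq_summary {R : realType} {dY : measure_display}
    {Y : measurableType dY} {nu : {sigma_finite_measure set Y -> \bar R}}
    {E : Type} {D : set (Y -> R)} {Phi : (Y -> R) -> E}
    {mu mu' : probability Y R} :
  law_eq mu mu' -> summary nu D Phi mu = summary nu D Phi mu'.
Proof.
(* Both laws have the same set of densities in [D], so [xget] makes the same choice. *)
move=> mumu'; congr (Phi (xget _ _)).
apply/seteqP; split=> f [Df muf]; split=> // A mA.
  by rewrite -mumu'// muf.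
by rewrite mumu'// muf.
Qed.

Theorem theorem5 (R : realType) (dO dZ : measure_display)
  (Omega : measurableType dO) (P : probability Omega R)
  (P_complete : measure_is_complete P)
  (T : {mfun Omega >-> bool})
  (Zc : measurableType dZ) (Zc_borel : standard_borel R Zc)
  (Z : {mfun Omega >-> Zc})
  (n : nat) (Yset : set (n.-tuple R)) (y0 : Yset)
  (Ypot : bool -> {mfun Omega >-> trace_space y0})
  (Yobs : {mfun Omega >-> trace_space y0})
  (consistency : {ae P, forall w, Yobs w = Ypot (T w) w})
  (* conditional laws L(Y(t) | T = s, Z = z) and L(Y(t) | Z = z) *)
  (Pts : bool -> bool -> Zc -> probability (trace_space y0) R)
  (Pts_law : forall t, is_cond_law P (Ypot t) (joint T Z)
     (fun sz => Pts t sz.1 sz.2))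
  (Pt : bool -> Zc -> probability (trace_space y0) R)
  (Pt_law : forall t, is_cond_law P (Ypot t) Z (Pt t))
  (* propensity score and positivity *)
  (e : Zc -> \bar R) (e_prop : is_cond_prob P (T @^-1` [set true]) Z e)
  (positivity : {ae distribution P Z, forall z, 0 < e z < 1})
  (* summary map Psi(mu) = Phi(f_mu), with Phi : D -> E measurable *)
  (nu : {sigma_finite_measure set (trace_space y0) -> \bar R})
  (D : set (trace_space y0 -> R)) (D_densities : D `<=` prob_density nu)
  (SD : set (set (trace_space y0 -> R))) (SD_sigma : sigma_algebra D SD)
  (E : completeNormedModType R) (Phi : (trace_space y0 -> R) -> E)
  (Phi_measurable : measurable_on_class D SD Phi)
  (* model class of laws *)
  (M : set (probability (trace_space y0) R))
  (M_densities : forall mu, M mu -> exists2 f, D f & is_density_of nu mu f)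
  (M_laws : forall t, {ae distribution P Z, forall z, M (Pts t t z) /\ M (Pt t z)})
  (Psi_inj : injective_on_laws M (summary nu D Phi)) :
  top_ignorable P Z (summary nu D Phi) Pts Pt <-> weakly_ignorable P T Z Ypot.
Proof.
pose g t z := if t then e z else 1 - e z.
have g_prop t : is_cond_prob P (T @^-1` [set t]) Z (g t).
  exact: is_cond_prob_treatment.
have g_pos t : {ae distribution P Z, forall z, 0 < g t z < +oo}.
  apply: filterS positivity => z /andP[e0 e1]; case: t; rewrite /g.
    by rewrite e0 (lt_trans e1) ?ltry.
  have ez : e z \is a fin_num.
    by rewrite ge0_fin_numE ?(lt_trans e1) ?ltry// ltW.
  by rewrite sube_gt0// e1 ltey_eq fin_numB ez.
have CI t := cond_indep_stratum (Pts_law t) (Pt_law t) (g_prop t) (g_pos t).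
split=> [PsiP t|YTZ t].
  (* Off a null set both laws lie in [M], where equal summaries force equal laws. *)
  apply/CI => A mA; apply: filter_app (M_laws t); apply: filterS (PsiP t).
  by move=> z Psiz [Mts Mt]; exact: Psi_inj Mts Mt Psiz A mA.
(* Conversely, equality for each [A] separately must become equality of laws off a single null set
   before summaries can be compared. *)
have cgY : countably_generated (trace_space y0).
  apply: countably_generated_trace; apply: countably_generated_tuple.
  exact: countably_generated_real.
have : {ae distribution P Z, forall z, law_eq (Pts t t z) (Pt t z)}.
  by apply: (ae_law_eq cgY); exact/CI.
by apply: filterS => z; exact: law_eq_summary.
Qed.
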